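(* Let $(R,\mathfrak{m})$ be a commutative Noetherian local ring and $\mathfrak{a}$ an ideal of $R$ with $\dim R/\mathfrak{a}\leq 1$. Let $M$ be an $R$-module. Then the local cohomology module $H^i_{\mathfrak{a}}(M)$ is weakly Laskerian for all $i\geq 0$.
   Context: $H^i_{\mathfrak{a}}(M)=\varinjlim_n \operatorname{Ext}^i_R(R/\mathfrak{a}^n,M)$ is the $i$-th local cohomology module of $M$ with respect to $\mathfrak{a}$. An $R$-module $X$ is weakly Laskerian if $\operatorname{Ass}_R(X/N)$ is a finite set for every submodule $N$ of $X$. *)

(* Defs.v *)
(* The development is classical: a subset of a module is turned into a boolean
   predicate by the [`[< _ >]] of [boolp].  Ideals of [A] are the submodules of
   [A^o]; unlike those of [ring_quotient], they need not be proper. *)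
From HB Require Import structures.
From mathcomp Require Import all_boot all_algebra ring_quotient.
From mathcomp Require Import boolp classical_sets functions cardinality.
From mathcomp.multinomials Require Import freeg.

Set Implicit Arguments.
Unset Strict Implicit.
Unset Printing Implicit Defensive.

Import GRing.Theory.
Local Open Scope ring_scope.
Local Open Scope classical_set_scope.

Notation ideal A := (submodClosed A^o).

Section MakeSubmodule.
Context (R : pzRingType) (V : lmodType R).

Definition is_submodule (S : set V) : Prop :=
  S 0 /\ forall (a : R) (u v : V), S u -> S v -> S (a *: u + v).

Definition submod_pred (S : set V) (hS : is_submodule S) (x : V) : bool :=
  `[< S x >].

Fact submod_pred_closed (S : set V) (hS : is_submodule S) :
  subsemimod_closed (submod_pred hS).
Proof.
apply: GRing.submod_closed_semi; split; first exact/asboolP/hS.1.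
by move=> a u v /asboolP Su /asboolP Sv; apply/asboolP/hS.2.
Qed.

HB.instance Definition _ (S : set V) (hS : is_submodule S) :=
  GRing.isSubmodClosed.Build R V (submod_pred hS) (submod_pred_closed hS).

Definition mk_submod (S : set V) (hS : is_submodule S) : submodClosed V :=
  GRing.SubmodClosed.clone R V (submod_pred hS) _.

Lemma mk_submodP (S : set V) (hS : is_submodule S) (x : V) :
  reflect (S x) (x \in mk_submod hS).
Proof. exact: asboolP. Qed.

Lemma is_submodule_mem (N : submodClosed V) : is_submodule [set` N].
Proof.
by split=> [|a u v Nu Nv]; rewrite /= ?rpred0// rpredD// rpredZ.
Qed.

End MakeSubmodule.

Section SubmoduleType.
Context (R : pzRingType) (V : lmodType R) (N : submodClosed V).

Definition submodule_type : Type := {x : V | x \in N}.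

HB.instance Definition _ := SubChoice.on submodule_type.
HB.instance Definition _ :=
  GRing.SubChoice_isSubLmodule.Build R V (mem N) submodule_type
    (GRing.subsemimodClosedP N).

End SubmoduleType.

Section QuotientModule.
Context (R : pzRingType) (V : lmodType R) (N : submodClosed V).

(* [submodClosed] does not inherit from the [zmodClosed] that [Quotient.quot]
   expects, although the two agree with scalars in a ring. *)
Definition submod_zmod : zmodClosed V :=
  GRing.ZmodClosed.clone V (submod_pred (is_submodule_mem N)) _.

Definition quotient_module : Type := Quotient.quot submod_zmod.

HB.instance Definition _ := GRing.Zmodule.on quotient_module.

Definition quotient_proj (x : V) : quotient_module :=
  (\pi_(Quotient.quot submod_zmod) x)%qT.

Definition quotient_repr (x : quotient_module) : V :=
  repr (x : Quotient.quot submod_zmod).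

Lemma quotient_reprK : cancel quotient_repr quotient_proj.
Proof. by move=> x; rewrite /quotient_proj reprK. Qed.

Lemma quotient_projP (x y : V) :
  reflect (quotient_proj x = quotient_proj y) (x - y \in N).
Proof.
have -> : (x - y \in N) = (x - y \in submod_zmod).
  by apply/idP/asboolP.
by rewrite Quotient.idealrBE; exact: eqP.
Qed.

Fact quotient_proj_additive : zmod_morphism quotient_proj.
Proof. by move=> x y; rewrite /quotient_proj raddfB. Qed.

HB.instance Definition _ :=
  GRing.isZmodMorphism.Build V quotient_module quotient_proj
    quotient_proj_additive.

Definition quotient_scale (a : R) (x : quotient_module) : quotient_module :=
  quotient_proj (a *: quotient_repr x).

Fact quotient_scaleE a (x : V) :
  quotient_scale a (quotient_proj x) = quotient_proj (a *: x).
Proof.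
apply/quotient_projP; rewrite -scalerBr rpredZ//.
by apply/quotient_projP; rewrite quotient_reprK.
Qed.

Fact quotient_scaleA a b x :
  quotient_scale a (quotient_scale b x) = quotient_scale (a * b) x.
Proof. by rewrite -[x]quotient_reprK !quotient_scaleE scalerA. Qed.

Fact quotient_scale1 : left_id 1 quotient_scale.
Proof. by move=> x; rewrite -[x]quotient_reprK quotient_scaleE scale1r. Qed.

Fact quotient_scaleDr : right_distributive quotient_scale +%R.
Proof.
move=> a x y; rewrite -[x]quotient_reprK -[y]quotient_reprK.
by rewrite -raddfD !quotient_scaleE scalerDr raddfD.
Qed.

Fact quotient_scaleDl x : {morph quotient_scale^~ x : a b / a + b}.
Proof.
move=> a b; rewrite -[x]quotient_reprK.
by rewrite !quotient_scaleE scalerDl raddfD.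
Qed.

HB.instance Definition _ := GRing.Zmodule_isLmodule.Build R quotient_module
  quotient_scaleA quotient_scale1 quotient_scaleDr quotient_scaleDl.

Fact quotient_proj_scalable : scalable quotient_proj.
Proof. by move=> a x; rewrite -quotient_scaleE. Qed.

HB.instance Definition _ :=
  GRing.isScalable.Build R V quotient_module *:%R quotient_proj
    quotient_proj_scalable.

End QuotientModule.

Section QuotientMap.
Context (R : pzRingType) (U V : lmodType R).
Context (M : submodClosed U) (N : submodClosed V).

(* The map [U/M -> V/N] induced by [f]; it is well defined and linear when
   [f] sends [M] into [N]. *)
Definition quotient_map (f : U -> V) (x : quotient_module M) :
  quotient_module N := quotient_proj N (f (quotient_repr x)).

Context (f : {linear U -> V}) (fMN : forall x, x \in M -> f x \in N).

Lemma quotient_mapE x :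
  quotient_map f (quotient_proj M x) = quotient_proj N (f x).
Proof.
apply/quotient_projP; rewrite -raddfB; apply/fMN/quotient_projP.
by rewrite quotient_reprK.
Qed.

Lemma quotient_map_linear : linear (quotient_map f).
Proof.
move=> a x y; rewrite -[x]quotient_reprK -[y]quotient_reprK.
by rewrite -linearP !quotient_mapE -linearP -linearP.
Qed.

End QuotientMap.

Arguments quotient_map {R U V} M N f x.

Section QuotientRing.
Context (A : comPzRingType) (I : ideal A).

Definition quotient_ring : Type := @quotient_module A A^o I.

HB.instance Definition _ := GRing.Lmodule.on quotient_ring.

Let proj (x : A) : quotient_ring := quotient_proj I x.

Definition quotient_mul (x y : quotient_ring) : quotient_ring :=
  proj (quotient_repr x * quotient_repr y).

Fact quotient_mulE x y : quotient_mul (proj x) (proj y) = proj (x * y).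
Proof.
have reprB z : quotient_repr (proj z) - z \in I.
  by apply: (introT (@quotient_projP A A^o I _ _)); rewrite quotient_reprK.
apply: (elimT (@quotient_projP A A^o I _ _)).
set x' := quotient_repr _; set y' := quotient_repr _.
have -> : x' * y' - x * y = x' *: (y' - y : A^o) + y *: (x' - x : A^o).
  rewrite /GRing.scale/= mulrBr mulrBr [y * x']mulrC [y * x]mulrC.
  by rewrite addrA subrK.
by apply: rpredD; apply: rpredZ; apply: reprB.
Qed.

Fact proj_surj (x : quotient_ring) : exists y, x = proj y.
Proof. by exists (quotient_repr x); rewrite /proj quotient_reprK. Qed.

Fact quotient_mulA : associative quotient_mul.
Proof.
move=> x y z; have [{}x ->] := proj_surj x; have [{}y ->] := proj_surj y.
by have [{}z ->] := proj_surj z; rewrite !quotient_mulE mulrA.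
Qed.

Fact quotient_mulC : commutative quotient_mul.
Proof.
move=> x y; have [{}x ->] := proj_surj x; have [{}y ->] := proj_surj y.
by rewrite !quotient_mulE mulrC.
Qed.

Fact quotient_mul1 : left_id (proj 1) quotient_mul.
Proof. by move=> x; have [{}x ->] := proj_surj x; rewrite quotient_mulE mul1r. Qed.

Fact quotient_mulDl : left_distributive quotient_mul +%R.
Proof.
have projD u v : proj u + proj v = proj (u + v) by rewrite /proj raddfD.
move=> x y z; have [{}x ->] := proj_surj x; have [{}y ->] := proj_surj y.
by have [{}z ->] := proj_surj z; rewrite !(quotient_mulE, projD) mulrDl.
Qed.

HB.instance Definition _ := GRing.Zmodule_isComPzRing.Build quotient_ring
  quotient_mulA quotient_mulC quotient_mul1 quotient_mulDl.

End QuotientRing.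

Section SubmoduleOperations.
Context (R : pzRingType).
Implicit Types U V : lmodType R.

Fact span_closed V (S : set V) :
  is_submodule [set x | forall N : submodClosed V, S `<=` [set` N] -> x \in N].
Proof.
split=> [N _|a u v hu hv N SN]; first exact: rpred0.
by rewrite rpredD ?rpredZ ?hu ?hv.
Qed.

Definition span V (S : set V) : submodClosed V := mk_submod (span_closed S).

Fact kernel_closed U V (f : {linear U -> V}) : is_submodule [set x | f x = 0].
Proof.
by split=> [|a u v /= fu fv]; rewrite /= ?linear0// linearP fu fv scaler0 addr0.
Qed.

Definition kernel U V (f : {linear U -> V}) : submodClosed U :=
  mk_submod (kernel_closed f).

Fact image_closed U V (f : {linear U -> V}) : is_submodule (range f).
Proof.
split=> [|a _ _ [x _ <-] [y _ <-]]; first by exists 0; rewrite ?linear0.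
by exists (a *: x + y); rewrite ?linearP.
Qed.

Definition image_submod U V (f : {linear U -> V}) : submodClosed V :=
  mk_submod (image_closed f).

Fact preimage_closed U V (f : {linear U -> V}) (N : submodClosed V) :
  is_submodule (f @^-1` [set` N]).
Proof.
split=> [|a u v Nu Nv]; rewrite /preimage/= ?linear0 ?rpred0// linearP.
by rewrite rpredD// rpredZ.
Qed.

Definition preimage_submod U V (f : {linear U -> V}) (N : submodClosed V) :
  submodClosed U := mk_submod (preimage_closed f N).

Fact zero_closed V : is_submodule [set 0 : V].
Proof. by split=> // a u v /= -> ->; rewrite scaler0 addr0. Qed.

Definition zero_submod V : submodClosed V := mk_submod (@zero_closed V).

End SubmoduleOperations.

Section Ideals.
Context (A : comPzRingType).
Implicit Types I J p m : ideal A.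

Definition ideal_mul I J : ideal A :=
  span [set x : A^o | exists u v : A, [/\ u \in I, v \in J & x = u * v]].

Fixpoint ideal_pow I (n : nat) : ideal A :=
  if n is k.+1 then ideal_mul I (ideal_pow I k) else span setT.

Lemma ideal_powS_sub I n x : x \in ideal_pow I n.+1 -> x \in ideal_pow I n.
Proof.
move=> /mk_submodP; apply => _ /= [u [v [_ Jv ->]]].
exact: (GRing.rpredZ (s := ideal_pow I n) u (v : A^o) Jv).
Qed.

Definition proper_ideal I : Prop := (1 : A) \notin I.

Definition prime_ideal p : Prop :=
  proper_ideal p /\ forall u v : A, u * v \in p -> u \in p \/ v \in p.

Definition maximal_ideal m : Prop :=
  proper_ideal m /\
  forall I, {subset m <= I} -> proper_ideal I -> I =i m.

Definition is_local m : Prop :=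
  maximal_ideal m /\ forall n : ideal A, maximal_ideal n -> n =i m.

Definition noetherian : Prop :=
  forall I, exists s : seq A, I =i span [set x : A^o | x \in s].

Definition prime_chain (p : nat -> ideal A) (k : nat) : Prop :=
  (forall j, (j <= k)%N -> prime_ideal (p j)) /\
  (forall j, (j < k)%N ->
     {subset p j <= p j.+1} /\ ~ {subset p j.+1 <= p j}).

(* In particular the zero ring has dimension [<= n] for every [n]. *)
Definition krull_dim_le (n : nat) : Prop :=
  forall (q : nat -> ideal A) (k : nat), prime_chain q k -> (k <= n)%N.

End Ideals.

Section AssociatedPrimes.
Context (R : comPzRingType).

Definition associated_primes (X : lmodType R) : set (set R) :=
  [set P | exists p : ideal R, [/\ prime_ideal p, P = [set` p] &
     exists x : X, P = [set r | r *: x = 0]]].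

Definition weakly_laskerian (X : lmodType R) : Prop :=
  forall N : submodClosed X, finite_set (associated_primes (quotient_module N)).

End AssociatedPrimes.

Section Hom.
Context (R : comPzRingType).
Implicit Types U V W M : lmodType R.

Fact hom_closed V M : is_submodule [set f : V -> M | linear f].
Proof.
split=> [a u v|a f g lf lg b u v]; first by rewrite scaler0 addr0.
rewrite !addrfctE !scalrfctE lf lg !scalerDr addrACA !scalerA.
by rewrite [a * b]mulrC.
Qed.

Definition hom V M : lmodType R := submodule_type (mk_submod (hom_closed V M)).

Definition hom_fun V M (f : hom V M) : V -> M := val f.

Fact hom_fun_linear V M (f : hom V M) : linear (hom_fun f).
Proof. by move: (valP f) => /mk_submodP. Qed.

HB.instance Definition _ V M (f : hom V M) :=
  GRing.isLinear.Build R V M *:%R (hom_fun f) (hom_fun_linear f).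

Fact precomp_subproof U V M (g : {linear U -> V}) (f : hom V M) :
  hom_fun f \o g \in mk_submod (hom_closed U M).
Proof. by apply/mk_submodP => a u v /=; rewrite !linearP. Qed.

Definition precomp U V M (g : {linear U -> V}) (f : hom V M) : hom U M :=
  Sub (hom_fun f \o g) (precomp_subproof g f).

Fact precomp_linear U V M (g : {linear U -> V}) : linear (@precomp U V M g).
Proof. by move=> a f h; apply/val_inj/funext. Qed.

HB.instance Definition _ U V M (g : {linear U -> V}) :=
  GRing.isLinear.Build R (hom V M) (hom U M) *:%R (@precomp U V M g)
    (@precomp_linear U V M g).

End Hom.

Section FreeResolution.
Context (R : comNzRingType).
Implicit Types U V W M : lmodType R.

(* The free module on the underlying set of [V], which surjects onto [V]. *)
Definition free_module V : lmodType R := {freeg V / R}.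

Fact fglift_linear (K : choiceType) M (f : K -> M) :
  linear (fglift f : {freeg K / R} -> M).
Proof.
have addP := lift_is_additive f.
pose F := GRing.isZmodMorphism.Build {freeg K / R} M (fglift f) addP.
pose g : {additive {freeg K / R} -> M} := HB.pack (fglift f) F.
move=> c D E; rewrite -[fglift f]/(g : _ -> _) raddfD; congr (_ + _).
rewrite -[D in RHS]freeg_sumE [c *: D]/(fgscale c D) /fgscale !raddf_sum /g /=.
by rewrite ?scaler_sumr; apply: eq_bigr => x _; rewrite !liftU scalerA.
Qed.

Definition free_eval V : free_module V -> V := fglift (@idfun V).

HB.instance Definition _ V :=
  GRing.isLinear.Build R (free_module V) V *:%R (@free_eval V)
    (fglift_linear idfun).

Definition free_map U V (f : U -> V) : free_module U -> free_module V :=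
  fglift (fun u => << f u >> : free_module V).

HB.instance Definition _ U V (f : U -> V) :=
  GRing.isLinear.Build R (free_module U) (free_module V) *:%R (free_map f)
    (fglift_linear _).


Lemma free_evalU V (x : V) : free_eval (<< x >> : free_module V) = x.
Proof. by rewrite /free_eval liftU scale1r. Qed.

Lemma free_linear_ext V W (f g : {linear free_module V -> W}) :
  (forall x, f << x >> = g << x >>) -> f =1 g.
Proof.
move=> fg D; rewrite -(freeg_sumE D) !linear_sum; apply: eq_bigr => x _.
have -> : << coeff x D *g x >> = coeff x D *: (<< x >> : free_module V).
  by apply/eqP/freeg_eqP => y; rewrite coeffZ !coeffU mul1r.
by rewrite !linearZ_LR fg.
Qed.

Lemma free_map_eval U V (f : {linear U -> V}) x :
  free_eval (free_map f x) = f (free_eval x).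
Proof.
pose f1 : {linear free_module U -> V} := @free_eval V \o free_map f.
pose f2 : {linear free_module U -> V} := f \o @free_eval U.
apply: (free_linear_ext (f := f1) (g := f2)) x => x /=.
by rewrite /free_map liftU scale1r !free_evalU.
Qed.

Definition first_syzygy V : lmodType R :=
  submodule_type (kernel (@free_eval V)).

Definition syzygy_incl V (x : first_syzygy V) : free_module V := val x.

HB.instance Definition _ V := GRing.Linear.copy (@syzygy_incl V)
  (val : first_syzygy V -> free_module V).

Fact first_syzygy_map_subproof U V (f : {linear U -> V}) (x : first_syzygy U) :
  free_map f (val x) \in kernel (@free_eval V).
Proof.
apply/mk_submodP; rewrite /= free_map_eval.
by have /mk_submodP/= -> := valP x; rewrite linear0.
Qed.

Definition first_syzygy_map U V (f : {linear U -> V}) (x : first_syzygy U) :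
  first_syzygy V := Sub (free_map f (val x)) (first_syzygy_map_subproof f x).

Fact first_syzygy_map_linear U V (f : {linear U -> V}) :
  linear (first_syzygy_map f).
Proof. by move=> a x y; apply/val_inj; rewrite /= !linearP. Qed.

HB.instance Definition _ U V (f : {linear U -> V}) :=
  GRing.isLinear.Build R (first_syzygy U) (first_syzygy V) *:%R
    (first_syzygy_map f) (first_syzygy_map_linear f).

Fixpoint syzygy V (i : nat) : lmodType R :=
  if i is j.+1 then first_syzygy (syzygy V j) else V.

Fixpoint syzygy_map U V (f : {linear U -> V}) (i : nat) :
    {linear syzygy U i -> syzygy V i} :=
  match i with
  | 0 => f
  | j.+1 => first_syzygy_map (syzygy_map f j)
  end.

(* The free resolution [... -> P 1 -> P 0 -> V -> 0] in which [P i.+1] is free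
   on the underlying set of the kernel of [P i -> P i.-1] (resp. [P 0 -> V]).
   It is functorial in [V]. *)
Definition resolution V i : lmodType R := free_module (syzygy V i).

Definition resolution_diff V i : resolution V i.+1 -> resolution V i :=
  @syzygy_incl (syzygy V i) \o @free_eval (syzygy V i.+1).

HB.instance Definition _ V i := GRing.Linear.on (@resolution_diff V i).

Definition resolution_map U V (f : {linear U -> V}) i :
  resolution U i -> resolution V i := free_map (syzygy_map f i).

HB.instance Definition _ U V (f : {linear U -> V}) i :=
  GRing.Linear.on (@resolution_map U V f i).

Arguments resolution_map {U V} f i x.

Lemma resolution_aug_surj V (x : V) : exists y : resolution V 0, free_eval y = x.
Proof. by exists << x >>; rewrite free_evalU. Qed.

Lemma resolution_exact0 V (y : resolution V 0) :
  free_eval y = 0 <-> exists z, resolution_diff z = y.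
Proof.
split=> [y0|[z <-]]; last by have /mk_submodP := valP (free_eval z).
have ky : y \in kernel (@free_eval V) by apply/mk_submodP.
exists << (Sub y ky : syzygy V 1) >>.
by rewrite /resolution_diff/= (free_evalU (Sub y ky : syzygy V 1)).
Qed.

Lemma resolution_exactS V i (y : resolution V i.+1) :
  resolution_diff y = 0 <-> exists z, resolution_diff z = y.
Proof.
split=> [y0|[z <-]]; last first.
  have /mk_submodP/= e0 := valP (free_eval z).
  by rewrite /resolution_diff/= [X in syzygy_incl X]e0 linear0.
have ky : y \in kernel (@free_eval (syzygy V i.+1)).
  by apply/mk_submodP/val_inj.
exists << (Sub y ky : syzygy V i.+2) >>.
by rewrite /resolution_diff/= (free_evalU (Sub y ky : syzygy V i.+2)).
Qed.

Lemma resolution_map_diff U V (f : {linear U -> V}) i x :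
  resolution_diff (resolution_map f i.+1 x) =
  resolution_map f i (resolution_diff x).
Proof. by rewrite /resolution_diff/= /resolution_map free_map_eval. Qed.

End FreeResolution.

Arguments resolution_diff {R} V i x.
Arguments resolution_map {R U V} f i x.

Section Ext.
Context (R : comNzRingType).
Implicit Types U V M : lmodType R.

Definition cochain V M i : lmodType R := hom (resolution V i) M.

Definition cochain_diff V M i : {linear cochain V M i -> cochain V M i.+1} :=
  precomp (resolution_diff V i).

Definition cocycles V M i : submodClosed (cochain V M i) :=
  kernel (cochain_diff V M i).

Definition coboundaries V M i : submodClosed (cochain V M i) :=
  match i with
  | 0 => zero_submod (cochain V M 0)
  | j.+1 => image_submod (cochain_diff V M j)
  end.

Definition cocycle_type V M i : lmodType R := submodule_type (cocycles V M i).

Definition cocycle_val V M i (z : cocycle_type V M i) : cochain V M i := val z.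

HB.instance Definition _ V M i := GRing.Linear.copy (@cocycle_val V M i)
  (val : cocycle_type V M i -> cochain V M i).

Definition cocycle_coboundaries V M i : submodClosed (cocycle_type V M i) :=
  preimage_submod (@cocycle_val V M i) (coboundaries V M i).

Definition Ext V M i : lmodType R :=
  quotient_module (cocycle_coboundaries V M i).

Context (U V M : lmodType R) (f : {linear U -> V}) (i : nat).

Definition cochain_map j : {linear cochain V M j -> cochain U M j} :=
  precomp (resolution_map f j).

Fact cochain_map_diff j (c : cochain V M j) :
  cochain_map j.+1 (cochain_diff V M j c) =
  cochain_diff U M j (cochain_map j c).
Proof.
by apply/val_inj/funext => x; rewrite /= /hom_fun/= /hom_fun/= resolution_map_diff.
Qed.

Fact cocycle_map_subproof (z : cocycle_type V M i) :
  cochain_map i (cocycle_val z) \in cocycles U M i.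
Proof.
apply/mk_submodP; rewrite /= -cochain_map_diff.
by have /mk_submodP/= -> := valP z; rewrite linear0.
Qed.

Definition cocycle_map (z : cocycle_type V M i) : cocycle_type U M i :=
  Sub (cochain_map i (cocycle_val z)) (cocycle_map_subproof z).

Fact cocycle_map_linear : linear cocycle_map.
Proof. by move=> a x y; apply/val_inj; rewrite /= !linearP. Qed.

HB.instance Definition _ :=
  GRing.isLinear.Build R (cocycle_type V M i) (cocycle_type U M i) *:%R
    cocycle_map cocycle_map_linear.

Fact cocycle_map_coboundaries z : z \in cocycle_coboundaries V M i ->
  cocycle_map z \in cocycle_coboundaries U M i.
Proof.
move=> /mk_submodP/= Bz; apply/mk_submodP => /=; rewrite /cocycle_val/=.
case: i z Bz => [|j] z /mk_submodP/= => [->|[c _ cz]]; apply/mk_submodP => /=.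
  by rewrite linear0.
by exists (cochain_map j c); rewrite // -cochain_map_diff /= cz.
Qed.

Definition Ext_map : Ext V M i -> Ext U M i :=
  quotient_map (cocycle_coboundaries V M i) (cocycle_coboundaries U M i)
    cocycle_map.

Fact Ext_map_linear : linear Ext_map.
Proof. exact: (quotient_map_linear cocycle_map_coboundaries). Qed.

HB.instance Definition _ :=
  GRing.isLinear.Build R (Ext V M i) (Ext U M i) *:%R Ext_map Ext_map_linear.

End Ext.

Arguments Ext_map {R U V} M f i x.

Section DirectLimit.
Context (R : pzRingType) (E : nat -> lmodType R).

Definition dproduct : Type := forall n, E n.

HB.instance Definition _ := Choice.on dproduct.

Definition dproduct_zero : dproduct := fun=> 0.
Definition dproduct_opp (x : dproduct) : dproduct := fun n => - x n.
Definition dproduct_add (x y : dproduct) : dproduct := fun n => x n + y n.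
Definition dproduct_scale (a : R) (x : dproduct) : dproduct :=
  fun n => a *: x n.

Fact dproduct_addA : associative dproduct_add.
Proof. by move=> x y z; apply: functional_extensionality_dep => n; apply: addrA. Qed.
Fact dproduct_addC : commutative dproduct_add.
Proof. by move=> x y; apply: functional_extensionality_dep => n; apply: addrC. Qed.
Fact dproduct_add0 : left_id dproduct_zero dproduct_add.
Proof. by move=> x; apply: functional_extensionality_dep => n; apply: add0r. Qed.
Fact dproduct_addN : left_inverse dproduct_zero dproduct_opp dproduct_add.
Proof. by move=> x; apply: functional_extensionality_dep => n; apply: addNr. Qed.

HB.instance Definition _ := GRing.isZmodule.Build dproduct
  dproduct_addA dproduct_addC dproduct_add0 dproduct_addN.

Fact dproduct_scaleA a b x :
  dproduct_scale a (dproduct_scale b x) = dproduct_scale (a * b) x.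
Proof. by apply: functional_extensionality_dep => n; apply: scalerA. Qed.
Fact dproduct_scale1 : left_id 1 dproduct_scale.
Proof. by move=> x; apply: functional_extensionality_dep => n; apply: scale1r. Qed.
Fact dproduct_scaleDr : right_distributive dproduct_scale +%R.
Proof. by move=> a x y; apply: functional_extensionality_dep => n; apply: scalerDr. Qed.
Fact dproduct_scaleDl x : {morph dproduct_scale^~ x : a b / a + b}.
Proof. by move=> a b; apply: functional_extensionality_dep => n; apply: scalerDl. Qed.

HB.instance Definition _ := GRing.Zmodule_isLmodule.Build R dproduct
  dproduct_scaleA dproduct_scale1 dproduct_scaleDr dproduct_scaleDl.

Fact direct_sum_closed : is_submodule
  [set x : dproduct | exists N, forall n, (N <= n)%N -> x n = 0].
Proof.
split=> [|a x y [Nx xP] [Ny yP]]; first by exists 0%N.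
exists (maxn Nx Ny) => n; rewrite geq_max => /andP[/xP x0 /yP y0].
by rewrite -[LHS]/(a *: x n + y n) x0 y0 scaler0 addr0.
Qed.

Definition direct_sum : lmodType R :=
  submodule_type (mk_submod direct_sum_closed).

Definition coord_fun n (x : E n) : dproduct := dfwith (fun k => 0 : E k) x.

Fact coord_fun_finite n (x : E n) :
  coord_fun x \in mk_submod direct_sum_closed.
Proof.
apply/mk_submodP; exists n.+1 => k nk; rewrite /coord_fun dfwith_out//.
by rewrite neq_ltn nk.
Qed.

Definition direct_sum_inj n (x : E n) : direct_sum :=
  Sub (coord_fun x) (coord_fun_finite x).

(* The direct limit of [E 0 -> E 1 -> E 2 -> ...] is the direct sum of the
   [E n] modulo the identification of each [x : E n] with [t n x : E n.+1]. *)
Definition limit_relations (t : forall n, {linear E n -> E n.+1}) :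
    submodClosed direct_sum :=
  span [set s | exists n (x : E n),
    s = direct_sum_inj x - direct_sum_inj (t n x)].

Definition direct_limit (t : forall n, {linear E n -> E n.+1}) : lmodType R :=
  quotient_module (limit_relations t).

Definition direct_limit_inj (t : forall n, {linear E n -> E n.+1}) n (x : E n) :
  direct_limit t := quotient_proj _ (direct_sum_inj x).

Lemma direct_limit_injS (t : forall n, {linear E n -> E n.+1}) n (x : E n) :
  direct_limit_inj t (t n x) = direct_limit_inj t x.
Proof.
apply/esym/quotient_projP/mk_submodP => L; apply.
by exists n, x.
Qed.

End DirectLimit.

Section LocalCohomology.
Context (R : comNzRingType) (I : ideal R).

Definition pow_quotient (n : nat) : lmodType R :=
  @quotient_module R R^o (ideal_pow I n).

Definition pow_quotient_proj (n : nat) :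
    pow_quotient n.+1 -> pow_quotient n :=
  quotient_map (ideal_pow I n.+1) (ideal_pow I n) (idfun : R^o -> R^o).

Fact pow_quotient_proj_linear n : linear (@pow_quotient_proj n).
Proof.
apply: (quotient_map_linear (f := (idfun : {linear R^o -> R^o}))) => x.
exact: ideal_powS_sub.
Qed.

HB.instance Definition _ n :=
  GRing.isLinear.Build R (pow_quotient n.+1) (pow_quotient n) *:%R
    (@pow_quotient_proj n) (@pow_quotient_proj_linear n).

Definition local_cohomology (M : lmodType R) (i : nat) : lmodType R :=
  @direct_limit R (fun n => Ext (pow_quotient n) M i)
    (fun n => Ext_map M (@pow_quotient_proj n) i).

End LocalCohomology.

(* Main.v *)
(* Every element of [Ext^i(R/a^n, M)] is annihilated by [a^n], so every element
   of the local cohomology module, and of each of its quotients, is annihilated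
   by a power of [a].  Hence the associated primes of such a quotient contain
   [a].  As [R] is local and [dim R/a <= 1], a prime above [a] is [m] or minimal
   over [a], and a Noetherian ring has finitely many primes minimal over [a]. *)
Require Import Defs.
From HB Require Import structures.
From mathcomp Require Import all_boot ssralg.
From mathcomp Require Import boolp classical_sets functions cardinality.
From mathcomp.multinomials Require Import freeg.

Set Implicit Arguments.
Unset Strict Implicit.
Unset Printing Implicit Defensive.

Import GRing.Theory.
Local Open Scope ring_scope.
Local Open Scope classical_set_scope.

(** * Maximal elements and minimal primes in Noetherian rings *)

Section Noetherian.
Context (R : comNzRingType).
Implicit Types I J K p q : ideal R.

Lemma ideal_mulr I (x y : R) : y \in I -> x * y \in I.
Proof. exact: (GRing.rpredZ (s := I) x (y : R^o)). Qed.

Lemma span_sub (S : set R^o) I : S `<=` [set` I] -> {subset span S <= I}.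
Proof. by move=> SI x /mk_submodP; apply. Qed.

Lemma mem_span (S : set R^o) x : S x -> x \in span S.
Proof. by move=> Sx; apply/mk_submodP => N; apply. Qed.

(** Zorn's lemma for inclusion. The union of a nonempty chain is a finitely generated ideal whose
    generators all lie in one member of the chain; that member equals the union, so the bound again
    satisfies [P]. *)
Lemma noetherian_maximal_element (P : ideal R -> Prop) I :
  noetherian R -> P I ->
  exists J, P J /\ forall K, P K -> {subset J <= K} -> {subset K <= J}.
Proof.
move=> nR PI; pose T := {J | P J}.
pose le (J K : T) := `[< {subset sval J <= sval K} >].
have le_refl t : le t t by apply/asboolP.
have le_trans r s t : le r s -> le s t -> le r t.
  by move=> /asboolP rs /asboolP st; apply/asboolP => x /rs/st.
have chain_ub (A : set T) : total_on A (fun x y => le x y) ->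
    exists t, forall s, A s -> le s t.
  move=> totA; have [[t0 At0]|A0] := pselect (A !=set0); last first.
    by exists (exist _ I PI) => s As; case: A0; exists s.
  have union_submod :
      is_submodule [set x : R^o | exists2 J, A J & x \in sval J].
    split=> [|r u v [J AJ Ju] [K AK Kv]]; first by exists t0; rewrite ?rpred0.
    have [/asboolP JK|/asboolP KJ] := totA _ _ AJ AK.
      by exists K; rewrite // rpredD// rpredZ// JK.
    by exists J; rewrite // rpredD ?rpredZ// KJ.
  have [s sE] := nR (mk_submod union_submod).
  have [t At st] : exists2 t, A t & forall x, x \in s -> x \in sval t.
    have : {subset s <= mk_submod union_submod}.
      by move=> x xs; rewrite sE; apply: mem_span.
    elim: s {sE} => [|x s IHs] sU; first by exists t0.
    have [t At st] : exists2 t, A t & forall x, x \in s -> x \in sval t.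
      by apply: IHs => y ys; apply: sU; rewrite in_cons ys orbT.
    have /(mk_submodP union_submod)[u Au ux] := sU x (mem_head x s).
    have [/asboolP tu|/asboolP ut] := totA _ _ At Au.
      by exists u => // y; rewrite in_cons => /orP[/eqP->//|/st/tu].
    by exists t => // y; rewrite in_cons => /orP[/eqP->|/st//]; apply: ut.
  exists t => u Au; apply/asboolP => x ux.
  have : x \in mk_submod union_submod by apply/mk_submodP; exists u.
  by rewrite sE; apply: span_sub => y /st.
have [[J PJ] maxJ] := ZL_preorder (exist _ I PI : T) le_refl le_trans chain_ub.
exists J; split=> // K PK JK; apply/asboolP.
exact: (maxJ (exist _ K PK) (asboolT JK)).
Qed.

(** A maximal element among the proper ideals containing [I] is a maximal ideal, hence is [m]. *)
Lemma proper_sub_local (m : ideal R) I :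
  noetherian R -> is_local m -> proper_ideal I -> {subset I <= m}.
Proof.
move=> nR [_ locm] pI.
pose P J := proper_ideal J /\ {subset I <= J}.
have [|J [[pJ IJ] maxJ]] := @noetherian_maximal_element P I nR; first by split.
have Jm : maximal_ideal J.
  split=> // K JK pK x; apply/idP/idP; last exact: JK.
  by apply: maxJ => //; split=> // y /IJ/JK.
by move=> x /IJ; rewrite (locm _ Jm).
Qed.

Fact adjoin_submodule I (u : R) :
  is_submodule [set x : R^o | exists2 y, y \in I & exists r, x = y + r * u].
Proof.
split=> [|r _ _ [y Iy [b ->]] [z Iz [c ->]]].
  by exists 0; [exact: rpred0|exists 0; rewrite mul0r addr0].
exists (r * y + z); first by rewrite rpredD// ideal_mulr.
by exists (r * b + c); rewrite [_ *: _]mulrDr mulrDl mulrA addrACA.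
Qed.

Definition adjoin I u : ideal R := mk_submod (adjoin_submodule I u).

Lemma adjoinP I (u x : R) :
  reflect (exists2 y, y \in I & exists r, x = y + r * u) (x \in adjoin I u).
Proof. exact: (@mk_submodP R R^o _ (adjoin_submodule I u)). Qed.

Lemma sub_adjoin I u : {subset I <= adjoin I u}.
Proof.
by move=> x Ix; apply/adjoinP; exists x => //; exists 0; rewrite mul0r addr0.
Qed.

Lemma mem_adjoin I u : u \in adjoin I u.
Proof.
by apply/adjoinP; exists 0; [exact: rpred0|exists 1; rewrite mul1r add0r].
Qed.

Lemma adjoin_sub I u J : {subset I <= J} -> u \in J -> {subset adjoin I u <= J}.
Proof.
move=> IJ Ju _ /adjoinP[y Iy [r ->]].
by apply: rpredD; [apply: IJ|apply: ideal_mulr].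
Qed.

(** Members of [F] may fail to be minimal over [I]. This laxity lets the families for [J + (u)] and
    [J + (v)] be united without any pruning. *)
Definition finite_minimal_primes I : Prop :=
  exists F : set (set R), [/\ finite_set F,
    (forall S, F S -> exists q,
        [/\ prime_ideal q, {subset I <= q} & S = [set` q]])
    & forall p, prime_ideal p -> {subset I <= p} ->
        exists2 S, F S & S `<=` [set` p]].

(* Noetherian induction: a maximal counterexample [J] is proper and not prime,
   say [u * v \in J], and every prime above [J] is above [J + (u)] or above
   [J + (v)]. *)
Lemma noetherian_finite_minimal_primes I :
  noetherian R -> finite_minimal_primes I.
Proof.
move=> nR; apply: contrapT => badI.
have [J [badJ maxJ]] :=
  @noetherian_maximal_element (fun I => ~ finite_minimal_primes I) I nR badI.
have good_adjoin u : u \notin J -> finite_minimal_primes (adjoin J u).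
  move=> Ju; apply: contrapT => /maxJ/(_ (@sub_adjoin J u)) uJ.
  by rewrite uJ ?mem_adjoin in Ju.
apply: badJ; have [pJ|nJ] := pselect (prime_ideal J).
  exists [set [set` J]]; split; first exact: finite_set1.
    by move=> _ ->; exists J; split.
  by move=> p _ Jp; exists [set` J].
(* No prime contains the unit ideal, so the empty family serves there. *)
have [J1|pJ] := boolP ((1 : R) \in J).
  exists set0; split=> // p [/negP p1 _] Jp; case: p1; exact: Jp.
have [u [v [Juv Ju Jv]]] : exists u v : R,
    [/\ u * v \in J, u \notin J & v \notin J].
  apply: contrapT => H; apply: nJ; split=> // u v Juv.
  have [|Ju] := boolP (u \in J); first by left.
  have [|Jv] := boolP (v \in J); first by right.
  by case: H; exists u, v.
have [F [finF primeF minF]] := good_adjoin u Ju.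
have [G [finG primeG minG]] := good_adjoin v Jv.
exists (F `|` G); split; first by rewrite finite_setU.
  move=> S [/primeF|/primeG] [q [pq qs ->]]; exists q; split=> // x Jx;
  by apply: qs; apply: sub_adjoin.
move=> p pp Jp; have [pu|pv] := pp.2 _ _ (Jp _ Juv).
  by have [S FS Sp] := minF p pp (adjoin_sub Jp pu); exists S => //; left.
by have [S FS Sp] := minG p pp (adjoin_sub Jp pv); exists S => //; right.
Qed.

End Noetherian.

(** * Chains of primes above [a], seen in [R/a] *)

Section QuotientRingPrimes.
Context (R : comPzRingType) (a : ideal R).
Implicit Types p q : ideal R.

Let proj (x : R) : quotient_ring a := @quotient_proj R R^o a x.

Let projP (x y : R) : proj x = proj y <-> x - y \in a.
Proof. by split=> /(@quotient_projP R R^o a x y). Qed.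

Fact image_ideal_submodule p :
  is_submodule [set x : (quotient_ring a)^o | exists2 y, y \in p & x = proj y].
Proof.
split=> [|r u v [x px ->] [y py ->]].
  by exists 0; [exact: rpred0|rewrite /proj raddf0].
have [s ->] := proj_surj r; exists (s * x + y).
  by rewrite rpredD//; apply: (GRing.rpredZ (s := p) s (x : R^o)).
rewrite /proj raddfD; congr (_ + _).
exact: quotient_mulE.
Qed.

Definition image_ideal p : ideal (quotient_ring a) :=
  mk_submod (image_ideal_submodule p).

Lemma image_idealP p (x : quotient_ring a) :
  reflect (exists2 y, y \in p & x = proj y) (x \in image_ideal p).
Proof.
exact: (@mk_submodP _ (quotient_ring a)^o _ (image_ideal_submodule p)).
Qed.

Lemma mem_image_ideal p (x : R) :
  {subset a <= p} -> (proj x \in image_ideal p) = (x \in p).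
Proof.
move=> ap; apply/image_idealP/idP => [[y py /projP/ap pxy]|px]; last by exists x.
by rewrite -[x](subrK y); apply: rpredD.
Qed.

Lemma image_ideal_prime p :
  {subset a <= p} -> prime_ideal p -> prime_ideal (image_ideal p).
Proof.
move=> ap [p1 pM]; split; first by rewrite /proper_ideal mem_image_ideal.
move=> u v; have [x ->] := proj_surj u; have [y ->] := proj_surj v.
rewrite [X in X \in _](quotient_mulE a x y).
by rewrite !mem_image_ideal//; apply: pM.
Qed.

Lemma image_ideal_strict p q : {subset a <= p} -> {subset a <= q} ->
  {subset p <= q} /\ ~ {subset q <= p} ->
  {subset image_ideal p <= image_ideal q} /\
  ~ {subset image_ideal q <= image_ideal p}.
Proof.
move=> ap aq [pq nqp]; split=> [x /image_idealP[y py ->]|qp].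
  by rewrite mem_image_ideal// pq.
by apply: nqp => x qx; rewrite -(mem_image_ideal _ ap) qp// mem_image_ideal.
Qed.

(** If both inclusions were strict, the images of [q], [p] and [m] would form a chain of length 2 in
    [R/a]. *)
Lemma no_prime_chain_above (p q m : ideal R) :
  krull_dim_le (quotient_ring a) 1 -> {subset a <= q} ->
  prime_ideal q -> prime_ideal p -> prime_ideal m ->
  {subset q <= p} -> {subset p <= m} -> {subset p <= q} \/ {subset m <= p}.
Proof.
move=> dim1 aq pq pp pm qp qm.
have ap : {subset a <= p} by move=> x /aq/qp.
have am : {subset a <= m} by move=> x /ap/qm.
have [|npq] := pselect {subset p <= q}; first by left.
have [|nmp] := pselect {subset m <= p}; first by right.
(* The default value [m] of [nth] supplies the term of index 2. *)
pose c j := image_ideal (nth m [:: q; p] j).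
suff /dim1 : prime_chain c 2 by [].
split=> [[|[|[|j]]]|[|[|j]]] // _; rewrite /c /=;
  by [apply: image_ideal_prime | apply: image_ideal_strict].
Qed.

End QuotientRingPrimes.

(** * Finiteness of the primes above [a], and power-torsion modules *)

Section PrimesAbove.
Context (R : comNzRingType).

Lemma maximal_ideal_prime (m : ideal R) : maximal_ideal m -> prime_ideal m.
Proof.
move=> [m1 maxm]; split=> // u v muv.
have [|mu] := boolP (u \in m); [by left|right].
have : (1 : R) \in adjoin m u.
  apply: contrapT => /negP /(maxm _ (@sub_adjoin _ m u)) um.
  by rewrite -um mem_adjoin in mu.
move=> /adjoinP[y my [r e]].
(* From [1 = y + r * u] follows [v = v * y + r * (u * v)], with both terms in [m]. *)
rewrite -[v]mul1r e mulrDl -mulrA [y * v]mulrC.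
by apply: (@GRing.rpredD _ m); apply: ideal_mulr.
Qed.

(** A prime [p] above [a] contains some [q] of the finite family and lies in [m]; the dimension
    bound collapses one of the two inclusions, so [p] is [q] or [m]. *)
Lemma finitely_many_primes_above (m a : ideal R) :
  noetherian R -> is_local m -> krull_dim_le (quotient_ring a) 1 ->
  finite_set [set P : set R | exists p : ideal R,
    [/\ prime_ideal p, {subset a <= p} & P = [set` p]]].
Proof.
move=> nR locm dim1.
have [F [finF primeF minF]] := noetherian_finite_minimal_primes a nR.
apply: (@sub_finite_set _ _ (F `|` [set [set` m]])); last first.
  by rewrite finite_setU; split=> //; apply: finite_set1.
move=> _ [p [pp ap ->]].
have [S FS Sp] := minF p pp ap; have [q [pq aq SE]] := primeF S FS.
have qp : {subset q <= p} by move=> x qx; apply: Sp; rewrite SE.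
have pm := proper_sub_local nR locm pp.1.
have pr_m := maximal_ideal_prime locm.1.
have [pq'|mp] := no_prime_chain_above dim1 aq pq pp pr_m qp pm.
  left; suff -> : [set` p] = S by [].
  by rewrite SE; apply/seteqP; split=> x /=; [apply: pq'|apply: qp].
by right; apply/seteqP; split=> x /=; [apply: pm|apply: mp].
Qed.

(** This says that [X] equals its [a]-torsion submodule; the exponent may depend on [x]. *)
Definition power_torsion (a : ideal R) (X : lmodType R) : Prop :=
  forall x : X, exists n, forall r, r \in ideal_pow a n -> r *: x = 0.

Lemma mem_ideal_pow (a : ideal R) (r : R) n :
  r \in a -> r ^+ n \in ideal_pow a n.
Proof.
move=> ar; elim: n => [|n IHn]; first exact: mem_span.
by apply: mem_span; exists r, (r ^+ n); rewrite exprS.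
Qed.

Lemma prime_ideal_exp (p : ideal R) (r : R) n :
  prime_ideal p -> r ^+ n \in p -> r \in p.
Proof.
move=> [p1 pM]; elim: n => [|n IHn]; first by rewrite expr0 => /(negP p1).
by rewrite exprS => /pM[|/IHn].
Qed.

(** If [p] is the annihilator of [x] in [X/N], a representative of [x] is killed by some [a^n];
    hence [p] contains [r^n] for each [r] in [a], and so contains [a]. *)
Lemma power_torsion_weakly_laskerian (m a : ideal R) (X : lmodType R) :
  noetherian R -> is_local m -> krull_dim_le (quotient_ring a) 1 ->
  power_torsion a X -> weakly_laskerian X.
Proof.
move=> nR locm dim1 torX N.
apply: sub_finite_set (finitely_many_primes_above nR locm dim1).
move=> _ [p [pp -> [x pE]]]; exists p; split=> // r ar.
have [n nx] := torX (quotient_repr x).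
apply: (@prime_ideal_exp _ _ n) => //.
suff : [set` p] (r ^+ n) by [].
rewrite pE /= -[x]quotient_reprK -linearZ /= nx ?linear0//.
exact: mem_ideal_pow.
Qed.

End PrimesAbove.

(** * An annihilator of [V] annihilates [Ext^i(V, M)] *)

Section ExtAnnihilator.
Context (R : comNzRingType).
Implicit Types U V W M : lmodType R.

Lemma corestriction U V (f : {linear U -> V}) (N : submodClosed V) :
  (forall x, f x \in N) ->
  exists g : {linear U -> submodule_type N}, forall x, val (g x) = f x.
Proof.
move=> fN; pose g x : submodule_type N := Sub (f x) (fN x).
have lg : linear g by move=> b x y; apply/val_inj; rewrite /= linearP.
pose g' : {linear U -> submodule_type N} :=
  HB.pack g (GRing.isLinear.Build R _ _ *:%R g lg).
by exists g'.
Qed.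

(** Projectivity of free modules: the basis element at [v] goes to the basis element at its image
    under [f]. *)
Lemma free_lift V W (f : {linear free_module V -> W}) :
  exists g : {linear free_module V -> free_module W},
    forall x, free_eval (g x) = f x.
Proof.
pose g : free_module V -> free_module W :=
  fglift (fun v => << f << v >> >> : free_module W).
have lg : linear g := fglift_linear _.
pose g' : {linear free_module V -> free_module W} :=
  HB.pack g (GRing.isLinear.Build R _ _ *:%R g lg).
exists g'; pose h : {linear free_module V -> W} := @free_eval R W \o g'.
apply: (free_linear_ext (f := h) (g := f)) => v.
by rewrite /h /= /g liftU scale1r free_evalU.
Qed.

(* Multiplication by [r] is null-homotopic on the resolution; composed with the
   differential [d], the homotopy [g] satisfies [d g d = r d], which is all that
   [Ext] needs. *)
Lemma resolution_homotopy V (r : R) : (forall v : V, r *: v = 0) ->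
  forall i, exists g : {linear resolution V i -> resolution V i.+1},
    forall z : syzygy V i.+1, free_eval (g (syzygy_incl z)) = r *: z.
Proof.
move=> rV i.
(* It suffices to extend multiplication by [r] from the syzygy to a map [t] on all of
   [resolution V i]; lifting [t] along [free_eval] gives [g]. *)
suff [t tE] : exists t : {linear resolution V i -> syzygy V i.+1},
    forall z, t (syzygy_incl z) = r *: z.
  by have [g gE] := free_lift t; exists g => z; rewrite gE tE.
elim: i => [|i [t tE]].
  pose f : {linear resolution V 0 -> resolution V 0} := r \*: idfun.
  have [x|t tE] := @corestriction _ _ f (kernel (@free_eval R V)).
    by apply/mk_submodP; rewrite /f /= linearZ_LR; apply: rV.
  by exists t => z; apply/val_inj; rewrite tE linearZ.
have [g gE] := free_lift t.
(* The map [r - g d] takes values in the next syzygy, since [free_eval] sends [g (d x)] to [r] times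
   [free_eval x]. On that syzygy [d] vanishes, leaving multiplication by [r]. *)
pose f : {linear resolution V i.+1 -> resolution V i.+1} :=
  (r \*: idfun) \- (g \o resolution_diff V i).
have [x|t' tE'] := @corestriction _ _ f (kernel (@free_eval R (syzygy V i.+1))).
  apply/mk_submodP; rewrite /f /= linearB linearZ_LR /= gE /resolution_diff /=.
  by rewrite tE subrr.
exists t' => z; apply/val_inj; rewrite tE' linearZ /f /=.
suff -> : resolution_diff V i (syzygy_incl z) = 0 by rewrite linear0 subr0.
have /mk_submodP/= e := valP z.
by rewrite /resolution_diff /= [X in syzygy_incl X]e linear0.
Qed.

(** A cocycle [z] vanishes on boundaries; together with the homotopy this makes [r z] a
    coboundary. *)
Lemma Ext_annihilated V M (r : R) i : (forall v : V, r *: v = 0) ->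
  forall x : Ext V M i, r *: x = 0.
Proof.
move=> rV x; rewrite -[x]quotient_reprK -linearZ -(linear0 (quotient_proj _)).
apply/quotient_projP; rewrite subr0; set z := quotient_repr x.
have zd y : hom_fun (cocycle_val z) (resolution_diff V i y) = 0.
  have /mk_submodP/= e := valP z.
  by have := congr1 (fun f => hom_fun f y) e; rewrite /hom_fun.
apply/mk_submodP; rewrite /preimage /= linearZ.
move: z zd; case: i x => [|i] x z zd; apply/mk_submodP => /=.
  apply/val_inj/funext => y /=.
  (* In degree 0 the only coboundary is 0. As [r] kills [V], the element [r y] is a boundary, so [z]
     kills it. *)
  have /resolution_exact0[w wE] : free_eval (r *: y : resolution V 0) = 0.
    by rewrite linearZ_LR; apply: rV.
  have := zd w; rewrite wE linearZ => e; exact: e.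
have [g gE] := resolution_homotopy rV i.
(* The cochain [z g] has coboundary [z g d], to be shown equal to [r z]. *)
pose b : {linear resolution V i -> M} := hom_fun (cocycle_val z) \o g.
have lb :
    (b : resolution V i -> M) \in mk_submod (hom_closed (resolution V i) M).
  by apply/mk_submodP => c u v; rewrite linearP.
exists (Sub (b : resolution V i -> M) lb) => //.
apply/val_inj/funext => y /=.
apply/eqP; rewrite -subr_eq0 -[X in _ - X]/(r *: hom_fun (cocycle_val z) y).
rewrite -linearZ /hom_fun /= -/(hom_fun _) -linearB.
(* By [d g d = r d], the element [g d y - r y] is a cycle, hence a boundary, and [z] vanishes on
   it. *)
have /resolution_exactS[w <-] :
    resolution_diff V i (g (resolution_diff V i y) - r *: y) = 0.
  rewrite linearB linearZ_LR; apply/eqP; rewrite subr_eq0; apply/eqP.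
  apply: (etrans (congr1 (@syzygy_incl _ _) (gE (free_eval y)))).
  exact: linearZ_LR.
exact/eqP/zd.
Qed.

End ExtAnnihilator.

(** * Power torsion of direct limits and of local cohomology *)

Section LocalCohomologyTorsion.
Context (R : comNzRingType) (a : ideal R).

Lemma pow_quotient_annihilated n (r : R) : r \in ideal_pow a n ->
  forall v : pow_quotient a n, r *: v = 0.
Proof.
move=> ar v; rewrite -[v]quotient_reprK -linearZ -(linear0 (quotient_proj _)).
apply/quotient_projP; rewrite subr0 [_ *: _]mulrC; exact: ideal_mulr.
Qed.

(** A representative supported in degrees below [N] is killed by [a^N], because the powers of [a]
    decrease. The induction on [N] peels off the top coordinate. *)
Lemma direct_limit_power_torsion (E : nat -> lmodType R)
    (t : forall n, {linear E n -> E n.+1}) :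
  (forall n r, r \in ideal_pow a n -> forall x : E n, r *: x = 0) ->
  power_torsion a (direct_limit t).
Proof.
move=> tor x; rewrite -[x]quotient_reprK.
set s := quotient_repr x; have /mk_submodP[N sN] := valP s.
exists N; elim: N s sN => [|N IHN] s sN r ar.
  have -> : s = 0 by apply/val_inj/functional_extensionality_dep => n; apply: sN.
  by rewrite linear0 scaler0.
(* The top coordinate now has degree [N], and [r] in [a^(N+1)] also lies in [a^N], as both the
   induction hypothesis and [tor] require. *)
have arN := ideal_powS_sub ar.
set e := direct_sum_inj (val s N).
rewrite -[s](subrK e) linearD scalerDr IHN// ?add0r.
  rewrite -linearZ; suff -> : r *: e = 0 by rewrite linear0.
  apply/val_inj/functional_extensionality_dep => n /=.
  rewrite -[LHS]/(r *: coord_fun (val s N) n) /coord_fun.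
  by case: dfwithP => [|j _]; [apply: tor | rewrite scaler0].
move=> n; rewrite leq_eqVlt => /orP[/eqP <-|Nn].
  rewrite -[LHS]/(val s N - coord_fun (val s N) N) /coord_fun dfwith_in.
  exact: subrr.
rewrite -[LHS]/(val s n - coord_fun (val s N) n) /coord_fun dfwith_out.
  by rewrite subr0; apply: sN.
by rewrite neq_ltn Nn.
Qed.

Lemma local_cohomology_power_torsion (M : lmodType R) i :
  power_torsion a (local_cohomology a M i).
Proof.
apply: direct_limit_power_torsion => n r ar.
exact/Ext_annihilated/pow_quotient_annihilated.
Qed.

End LocalCohomologyTorsion.

Theorem theorem3p6 (R : comNzRingType) (m a : ideal R)
    (noetherianR : noetherian R) (localR : is_local m)
    (dim_le1 : krull_dim_le (quotient_ring a) 1)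
    (M : lmodType R) (i : nat) :
  weakly_laskerian (local_cohomology a M i).
Proof.
apply: power_torsion_weakly_laskerian noetherianR localR dim_le1 _.
exact: local_cohomology_power_torsion.
Qed.
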